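(* Let $(r_k)_{k\ge0}$ be a real sequence and let $g_0\in C^\infty((0,\infty))$ be a real-valued function such that for some $\alpha>0$ and all integers $k\ge0$, $$\lim_{x\to0}x^{k-\alpha}g_0^{(k)}(x)=\lim_{x\to\infty}x^{k+1+\alpha}g_0^{(k)}(x)=0.$$ Define functions $g_k$, $k\ge1$, by the induction $g_{k+1}(x)=-x g_k'(x)-r_k g_k(x)$ for $k\ge0$. Then for all integers $k\ge0$ and $j\ge1$, $$\left\langle g_k^\times,g_j^\times\right\rangle+\left\langle g_{k+1}^\times,g_{j-1}^\times\right\rangle=(1-r_k-r_{j-1})\left\langle g_k^\times,g_{j-1}^\times\right\rangle.$$
   Context: $\{y\}$ denotes the fractional part of a real number $y$. For $g:(0,\infty)\to\mathbb{R}$ with $\int_0^\infty|g(x)|\,dx<\infty$ and $\int_0^\infty|g(x)|\frac{dx}{x}<\infty$ (which holds for all $g_k$ in the statement), define for $t>0$ $$g^\times(t)=\int_0^\infty\left\{\frac{x}{t}\right\}g(x)\,\frac{dx}{x},$$ which belongs to $L^2(0,\infty)$, and write $g_k^\times=(g_k)^\times$. The scalar product is that of $L^2(0,\infty)$: $\langle f,g\rangle=\int_0^\infty f(t)g(t)\,dt$ for real functions $f,g$. *)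

(* Defs.v *)
From HB Require Import structures.
From mathcomp Require Import all_boot all_order all_algebra.
From mathcomp Require Import all_classical all_reals all_analysis.

Set Implicit Arguments.
Unset Strict Implicit.
Unset Printing Implicit Defensive.

Import Order.TTheory GRing.Theory Num.Theory.
Import numFieldNormedType.Exports.

Local Open Scope classical_set_scope.
Local Open Scope ring_scope.

(* A real function on (0, oo) is encoded as a total
   function R -> R; only its values on (0, oo) are ever used. *)

Definition frac (R : realType) (y : R) : R := y - (Num.floor y)%:~R.

(* Since (0, oo) is open, the iterated derivatives of g at x > 0 depend only
   on the restriction of g to (0, oo). *)
Definition smooth_pos (R : realType) (g : R -> R) : Prop :=
  forall (n : nat) (x : R), 0 < x -> derivable (derive1n n g) x 1.

Definition gtimes (R : realType) (g : R -> R) (t : R) : R :=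
  \int[@lebesgue_measure R]_(x in `]0, +oo[) (frac (x / t) * g x / x).

(* Rintegral is the Lebesgue integral as a real number, set to 0 when that
   integral is infinite; on a pair of functions of L^2(0, oo) the integrand is
   integrable and this is the usual scalar product. *)
Definition dotL2 (R : realType) (f h : R -> R) : R :=
  \int[@lebesgue_measure R]_(t in `]0, +oo[) (f t * h t).

(* Main.v *)
Require Import Defs.
From HB Require Import structures.
From mathcomp Require Import all_boot all_order all_algebra.
From mathcomp Require Import all_classical all_reals all_analysis.
From mathcomp Require Import measurable_realfun ring lra.

Import Order.TTheory GRing.Theory Num.Theory.
Import numFieldNormedType.Exports.

Local Open Scope classical_set_scope.
Local Open Scope ring_scope.

(** The identity is an integration by parts. Write F_n for the transform of g_n.
    The substitution x = t * u turns the definition of F_n into the integral of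
    frac u * g_n (t * u) / u over u > 0, where the variable t occurs only inside
    the smooth function g_n. Differentiating under the integral sign shows that
    t * F_n'(t) is the transform of x * g_n'(x), that is, by the recursion,
    t * F_n' = - F_(n+1) - r_n * F_n on (0, oo) ([is_derive_gtimes]). Hence
    the derivative of t * F_k(t) * F_(j-1)(t) is
    (1 - r_k - r_(j-1)) * F_k F_(j-1) - F_k F_j - F_(k+1) F_(j-1),
    and the claim says that this derivative has integral 0 over (0, oo). It does,
    because (1 + t) * |F_n(t)| is bounded ([gtimes_bounded]): the products
    F_m F_n are then integrable, and t * F_k(t) * F_(j-1)(t) tends to 0 at both
    ends of (0, oo).

    All the estimates use one weight, [bump a x] = x^a / (1 + x^a)^2. It
    behaves like x^a at 0 and like x^(-a) at infinity, bump a x / x has the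
    explicit primitive -1 / (a * (1 + x^a)) and so is integrable, and a dilation
    of x changes bump by a bounded factor only. The hypotheses on g_0 say that
    (1 + x) * |x^i g_0^(i)(x)| is at most a constant times bump alpha x, for
    every i ([tame_of_limits]). Each g_n is a linear combination of the
    x^i g_0^(i), since the span of these functions is stable under the Euler
    operator x d/dx ([euler_span_derive]), so each g_n satisfies the same
    bound. *)

Local Notation mu := lebesgue_measure.

(** The half-line (0, oo), typed as a subset of the measurable space of reals
    so that Lebesgue integrability over it is well-typed without annotations. *)
Definition pos {R : realType} : set (measurableTypeR R) := `]0, +oo[%classic.

Lemma posP (R : realType) (x : R) : pos x <-> 0 < x.
Proof. by rewrite /pos /= in_itv/= andbT. Qed.

Lemma measurable_pos (R : realType) : measurable (@pos R).
Proof. exact: measurable_itv. Qed.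
#[local] Hint Resolve measurable_pos : core.

(** * Dilations of Lebesgue measure *)

(** Both sides are measures in A, so it suffices to compare them on bounded
    half-open intervals. *)
Lemma lebesgue_measure_dilation (R : realType) (c : {nonneg R})
    (A : set (measurableTypeR R)) : 0 < c%:num -> measurable A ->
  lebesgue_measure A = pushforward (mscale c (@lebesgue_measure R))
    (fun u : measurableTypeR R => c%:num * u : measurableTypeR R) A.
Proof.
move=> c0 mA.
have mc : measurable_fun [set: measurableTypeR R]
    (fun u : measurableTypeR R => c%:num * u : measurableTypeR R).
  exact: measurable_funM.
apply: (@lebesgue_measure_unique R (pushforward _ _)) => // _ [[a b] _ <-] /=.
rewrite /mscale /pushforward /=.
have -> : (fun u : R => c%:num * u) @^-1` `]a, b] = `]a / c%:num, b / c%:num]%classic.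
  by apply/seteqP; split => u /=; rewrite !in_itv/= ltr_pdivrMr// ler_pdivlMr// mulrC.
rewrite !lebesgue_measure_itv/= !lte_fin ltr_pM2r ?invr_gt0//.
case: ifPn => _; last by rewrite mule0.
by rewrite -!EFinB -EFinM -mulrBl mulrCA divff ?mulr1// gt_eqF.
Qed.

Lemma ge0_integral_dilation (R : realType) (c : R) (f : R -> \bar R) :
  0 < c -> measurable_fun pos f -> (forall x : R, (0 < x)%R -> (0 <= f x)%E) ->
  (\int[mu]_(x in pos) f x = c%:E * \int[mu]_(u in pos) f (c * u)%R)%E.
Proof.
move=> c0 mf f0.
have f0' x : pos x -> (0 <= f x)%E by move/posP => /f0.
pose C := NngNum (ltW c0).
have mc : measurable_fun [set: measurableTypeR R]
    (fun u : measurableTypeR R => C%:num * u : measurableTypeR R).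
  exact: measurable_funM.
have cpos : (fun u : measurableTypeR R => C%:num * u : measurableTypeR R) @^-1` pos = pos.
  by apply/seteqP; split => u /posP u0; apply/posP; move: u0; rewrite pmulr_rgt0.
transitivity (\int[pushforward (mscale C (@lebesgue_measure R))
    (fun u : measurableTypeR R => (C%:num * u)%R : measurableTypeR R)]_(x in pos) f x)%E.
  apply: (@eq_measure_integral _ _ _ _ (pushforward _ _)) => // A mA _.
  exact: lebesgue_measure_dilation.
rewrite ge0_integral_pushforward//; last by move=> x /set_mem; exact: f0'.
rewrite cpos ge0_integral_mscale//.
- apply: (measurable_comp (F := pos)) => //.
    by move=> _ [u /posP u0 <-]; apply/posP; exact: mulr_gt0.
  exact: measurable_funS mc.
- by move=> u /posP u0; rewrite f0// mulr_gt0.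
Qed.

(** The integrand met below, frac (x / t) * f x / x, is discontinuous, so the
    change of variable is obtained from the image measure and not from the
    fundamental theorem of calculus. *)
Lemma integral_dilation (R : realType) (c : R) (f : R -> R) :
  0 < c -> mu.-integrable pos (EFin \o f) ->
  mu.-integrable pos (EFin \o (fun u => f (c * u))) /\
  \int[mu]_(x in pos) f x = c * \int[mu]_(u in pos) f (c * u).
Proof.
move=> c0 intf.
have mfc (h : R -> \bar R) : measurable_fun pos h ->
    measurable_fun pos (fun u => h (c * u)).
  move=> mh; apply: (measurable_comp (F := pos)) => //.
  by move=> _ [u /posP u0 <-]; apply/posP; exact: mulr_gt0.
have intfc : mu.-integrable pos (EFin \o (fun u => f (c * u))).
  apply/integrableP; have /integrableP[mf foo] := intf; split; first exact: mfc mf.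
  move: foo; rewrite (@ge0_integral_dilation _ c)//; last exact: measurableT_comp.
  rewrite -[X in (_ < X)%E -> _](@gt0_muley _ c%:E) ?lte_fin//.
  by rewrite lte_pmul2l// lte_fin.
split => //.
have mf : measurable_fun pos (EFin \o f) by case/integrableP : intf.
have cfin (h : \bar R) : fine (c%:E * h) = c * fine h.
  by case: h => [h| |] //=; rewrite /mule/= ?gt_eqF ?lte_fin//= ?c0//= mulr0.
rewrite /Rintegral integralE [in RHS]integralE.
rewrite (@ge0_integral_dilation _ c)//; last exact: measurable_funepos.
rewrite (@ge0_integral_dilation _ c _ c0 (measurable_funeneg mf))//.
have posE : (fun u => (EFin \o f)^\+ (c * u)%R)%E =
    ((EFin \o (fun u => f (c * u)%R))^\+)%E.
  by apply/funext => u; rewrite !funeposE.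
have negE : (fun u => (EFin \o f)^\- (c * u)%R)%E =
    ((EFin \o (fun u => f (c * u)%R))^\-)%E.
  by apply/funext => u; rewrite !funenegE.
rewrite posE negE.
rewrite -muleBr//; last first.
  have intn := integrable_funeneg (@measurable_pos R) intfc.
  rewrite fin_num_adde_defl// fin_numN.
  exact: (integrable_fin_num (@measurable_pos R) intn).
Qed.

(** * Integrating a derivative over the half-line *)

Lemma continuous_pos_measurable (R : realType) (f : R -> R) :
  (forall x : R, 0 < x -> {for x, continuous f}) -> measurable_fun pos f.
Proof.
move=> cf; apply: open_continuous_measurable_fun; first exact: interval_open.
by move=> x /set_mem/posP; exact: cf.
Qed.

Lemma is_derive1_continuous (R : realType) (f : R -> R) (x d : R) :
  is_derive x 1 f d -> {for x, continuous f}.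
Proof. by move=> [df _]; apply/differentiable_continuous/derivable1_diffP. Qed.

Lemma integral_itv_primitive (R : realType) (f F : R -> R) (a b : R) :
  0 < a -> a < b -> (forall x : R, 0 < x -> {for x, continuous f}) ->
  (forall x : R, 0 < x -> is_derive x 1 F (f x)) ->
  (\int[mu]_(x in `[a, b]) (f x)%:E = (F b)%:E - (F a)%:E)%E.
Proof.
move=> a0 ab cf dF; have b0 := lt_trans a0 ab.
apply: continuous_FTC2 => //.
- apply: continuous_in_subspaceT => x; rewrite inE/= in_itv/= => /andP[ax _].
  exact/cf/(lt_le_trans a0).
- split.
  + by move=> x; rewrite in_itv/= => /andP[/(lt_trans a0)/dF[]].
  + by apply: cvg_at_right_filter; exact: is_derive1_continuous (dF _ a0).
  + by apply: cvg_at_left_filter; exact: is_derive1_continuous (dF _ b0).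
- move=> x; rewrite in_itv/= => /andP[/(lt_trans a0)/dF Fx _].
  by rewrite derive1E derive_val.
Qed.

(** An exhaustion of (0, oo) by nondegenerate compact intervals: with n.+2
    the lower end is always strictly below the upper one. *)
Definition pos_itv (R : realType) (n : nat) : set (measurableTypeR R) :=
  `[n.+2%:R^-1, n.+2%:R]%classic.

Lemma pos_itv_lt (R : realType) (n : nat) : (n.+2%:R^-1 : R) < n.+2%:R.
Proof.
apply: (@lt_trans _ _ 1); last by rewrite ltr1n.
by rewrite invf_lt1 ?ltr1n.
Qed.

Lemma bigcup_pos_itv (R : realType) : \bigcup_n (@pos_itv R n) = pos.
Proof.
apply/seteqP; split => x.
  move=> [n _] xn; apply/posP; move: xn; rewrite /pos_itv /= in_itv/= => /andP[+ _].
  by apply: lt_le_trans; rewrite invr_gt0.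
move=> /posP x0.
exists (Num.truncn (Num.max x x^-1)) => //.
have h : Num.max x x^-1 <= (Num.truncn (Num.max x x^-1)).+2%:R.
  rewrite -natr1 ler_wpDr// ltW// truncnS_gt//.
rewrite /pos_itv /= in_itv/=; apply/andP; split.
  by rewrite -[leRHS]invrK lef_pV2 ?posrE ?invr_gt0// (le_trans _ h)// le_max lexx orbT.
by rewrite (le_trans _ h)// le_max lexx.
Qed.

Lemma nondecreasing_pos_itv (R : realType) : nondecreasing_seq (@pos_itv R).
Proof.
move=> m n mn; apply/subsetPset; apply: subset_itv; rewrite bnd_simp.
  by rewrite lef_pV2 ?posrE// ler_nat !ltnS.
by rewrite ler_nat !ltnS.
Qed.

(** By monotone convergence along the exhaustion: on each compact interval the
    integral is a difference of two values of F, hence at most 2 * M. *)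
Lemma integrable_bounded_primitive (R : realType) (f F : R -> R) (M : R) :
  (forall x : R, 0 < x -> {for x, continuous f}) -> (forall x : R, 0 < x -> 0 <= f x) ->
  (forall x : R, 0 < x -> is_derive x 1 F (f x)) -> (forall x : R, 0 < x -> `|F x| <= M) ->
  mu.-integrable pos (EFin \o f).
Proof.
move=> cf f0 dF FM.
have mf : measurable_fun pos (EFin \o f).
  by apply/measurable_EFinP; exact: continuous_pos_measurable.
have subpos n : pos_itv R n `<=` pos.
  by rewrite -bigcup_pos_itv; exact: bigcup_sup.
have f0' x : pos x -> 0 <= f x by move/posP; exact: f0.
apply/integrableP; split => //.
under eq_integral => x /set_mem/f0' fx do rewrite gee0_abs ?lee_fin//.
have cvg_int : (\int[mu]_(x in pos_itv R n) (f x)%:E)%E @[n --> \oo] -->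
    (\int[mu]_(x in pos) (f x)%:E)%E.
  rewrite -bigcup_pos_itv; apply: ge0_nondecreasing_set_cvg_integral => //.
  - exact: nondecreasing_pos_itv.
  - by move=> n; exact: measurable_itv.
  - by move=> n; apply: measurable_funS mf => //; exact: subpos.
  - by move=> n x /subpos/f0'; rewrite lee_fin.
apply: (@le_lt_trans _ _ (M + M)%:E); last exact: ltry.
rewrite -(cvg_lim _ cvg_int)//; apply: lime_le.
  by apply: (cvgP _ cvg_int).
apply: nearW => n; rewrite (@integral_itv_primitive _ f F)//.
  rewrite -EFinB lee_fin (le_trans (ler_norm _))// (le_trans (ler_normB _ _))//.
  by rewrite lerD// FM.
exact: pos_itv_lt.
Qed.

(** By dominated convergence along the exhaustion, with `|f| as the dominating
    function: the integral is the limit of the differences of the values of F at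
    the ends of the intervals. *)
Lemma Rintegral_primitive_vanishing (R : realType) (f F : R -> R) :
  (forall x : R, 0 < x -> {for x, continuous f}) ->
  (forall x : R, 0 < x -> is_derive x 1 F (f x)) ->
  mu.-integrable pos (EFin \o f) ->
  F x @[x --> 0^'+] --> 0 -> F x @[x --> +oo] --> 0 ->
  \int[mu]_(x in pos) f x = 0.
Proof.
move=> cf dF intf F0 Foo.
have mf : measurable_fun pos (EFin \o f) by case/integrableP : intf.
have mE n : measurable (pos_itv R n) by exact: measurable_itv.
have subpos n : pos_itv R n `<=` pos.
  by rewrite -bigcup_pos_itv; exact: bigcup_sup.
pose f_ n := (EFin \o f) \_ (pos_itv R n).
have [//||||||_ _] := @dominated_convergence _ _ _ (@lebesgue_measure R) pos _ f_
  (EFin \o f) (abse \o (EFin \o f)) => //.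
- move=> n; rewrite /f_; apply/measurable_restrict => //.
  by apply: measurable_funS mf => //; exact: subIsetl.
- apply/aeW => x; rewrite -bigcup_pos_itv => -[N _ Nx].
  apply: cvg_near_cst; near=> n.
  rewrite /f_ patchE mem_set//.
  have /subsetPset : (pos_itv R N <= pos_itv R n)%O.
    by apply: nondecreasing_pos_itv; near: n; exact: nbhs_infty_ge.
  exact.
- exact: integrable_abse.
- apply/aeW => x n _; rewrite /f_ patchE; case: ifPn => // _.
  by rewrite abse0 /= lee_fin.
have intE n : (\int[mu]_(x in pos) f_ n x = (F n.+2%:R - F n.+2%:R^-1)%:E)%E.
  rewrite -integral_mkcondr (setIidr (@subpos n)).
  rewrite (@integral_itv_primitive _ f F)//; exact: pos_itv_lt.
rewrite [X in X @ _ --> _](_ : _ = fun n => (F n.+2%:R - F n.+2%:R^-1)%:E); last first.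
  by apply/funext => n; exact: intE.
have n2oo : n.+2%:R @[n --> \oo] --> (+oo : set_system R).
  have := @cvgr_idn R; rewrite -(cvg_shiftn 2).
  by under eq_fun do rewrite addn2.
have G0 : (F n.+2%:R - F n.+2%:R^-1)%:E @[n --> \oo] --> (0%R : R)%:E.
  apply: cvg_EFin; first exact: nearW.
  rewrite -[0%R](subr0 (0 : R)); apply: cvgB.
    exact: (cvg_comp _ _ n2oo Foo).
  apply: (iffLR (cvg_at_rightP _ _ _) F0); split => [n|]; first by rewrite invr_gt0.
  by have := @cvg_harmonic R; rewrite -(cvg_shiftn 1); under eq_fun do rewrite addn1.
by move=> /(cvg_unique _ G0) => /(_ (@ereal_hausdorff _)) h; rewrite /Rintegral -h.
Unshelve. all: by end_near. Qed.

(** * An integrable weight with controlled dilations *)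

(** The factor 1 + x^a is squared so that bump a x / x is the derivative of a
    bounded function, integrable both at 0 and at infinity. *)
Definition bump {R : realType} (a x : R) : R := x `^ a / (1 + x `^ a) ^+ 2.

Section bump.
Context {R : realType} (a : R).
Hypothesis a_gt0 : 0 < a.

Lemma powR1D_gt0 (x : R) : 0 < 1 + x `^ a.
Proof. by rewrite ltr_pwDl// powR_ge0. Qed.

Lemma bump_ge0 (x : R) : 0 <= bump a x.
Proof. by rewrite /bump divr_ge0// ?powR_ge0// exprn_ge0// ltW// powR1D_gt0. Qed.

Lemma is_derive_bump (x : R) : 0 < x ->
  is_derive x 1 (fun x => - (a * (1 + x `^ a))^-1) (bump a x / x).
Proof.
move=> x0.
have aD0 : a * (1 + x `^ a) != 0 by rewrite mulf_neq0// gt_eqF// powR1D_gt0.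
have dp := is_derive1_powR a x0.
have dq : is_derive x 1 (fun x => a * (1 + x `^ a)) (a * (a * x `^ (a - 1))).
  by apply: is_derive_eq; rewrite add0r mul1r.
have dV := is_deriveV (f := fun x => a * (1 + x `^ a)) aD0 dq.
apply: (is_derive_eq (is_deriveN dV)).
have -> : x `^ (a - 1) = x `^ a / x by rewrite powRB ?(gt_eqF x0) ?implybT// powRr1 ?ltW.
rewrite /bump.
rewrite /GRing.scale/=.
have := powR1D_gt0 x; set q := x `^ a => q0.
field.
by rewrite !gt_eqF.
Qed.

Lemma continuous_bump (x : R) : 0 < x -> {for x, continuous (bump a)}.
Proof.
move=> x0; have dp := is_derive1_powR a x0.
have D0 : (1 + x `^ a) ^+ 2 != 0 by rewrite expf_neq0// gt_eqF// powR1D_gt0.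
have cp : {for x, continuous (fun x => x `^ a)} by exact: is_derive1_continuous dp.
apply: cvgM => //; apply: cvgV => //.
have dD : is_derive x 1 (fun x => 1 + x `^ a) (a * x `^ (a - 1)).
  by apply: is_derive_eq; rewrite add0r mul1r.
rewrite expr2; under eq_fun do rewrite expr2.
  by apply: cvgM; exact: is_derive1_continuous dD.
Qed.

Lemma integrable_bump : mu.-integrable pos (EFin \o (fun x => bump a x / x)).
Proof.
apply: (@integrable_bounded_primitive _ _ (fun x => - (a * (1 + x `^ a))^-1) a^-1).
- move=> x x0; apply: cvgM; first exact: continuous_bump.
  by apply: cvgV => //; rewrite gt_eqF.
- by move=> x x0; rewrite divr_ge0 ?bump_ge0// ltW.
- exact: is_derive_bump.
- move=> x x0; have aD0 : 0 < a * (1 + x `^ a) by rewrite mulr_gt0// powR1D_gt0.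
  rewrite normrN gtr0_norm ?invr_gt0// lef_pV2//.
  by rewrite ler_pMr// lerDl powR_ge0.
Qed.

(** This provides, for all t in a compact interval [u, v], a common integrable
    bound of bump a (t * x) / x. It follows from
    min 1 (u^a) * (1 + x^a) <= 1 + (t * x)^a. *)
Lemma bump_dilation (u v t x : R) : 0 < u -> u <= t -> t <= v -> 0 < x ->
  bump a (t * x) <= v `^ a / Num.min 1 (u `^ a) ^+ 2 * bump a x.
Proof.
move=> u0 ut tv x0; have t0 := lt_le_trans u0 ut; have v0 := lt_le_trans t0 tv.
have pow_le (y z : R) : 0 < y -> y <= z -> y `^ a <= z `^ a.
  by move=> y0 yz; rewrite ge0_ler_powR ?nnegrE ?(ltW a_gt0) ?(ltW y0)// (le_trans (ltW y0)).
have := pow_le _ _ t0 tv; have := pow_le _ _ u0 ut.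
rewrite /bump (powRM _ (ltW t0) (ltW x0)).
have := powR_gt0 a x0; have := powR_gt0 a t0; have := powR_gt0 a u0.
have := powR_gt0 a v0.
set U := u `^ a; set V := v `^ a; set T := t `^ a; set q := x `^ a.
move=> V0 U0 T0 q0 UT TV; set m := Num.min 1 U.
have m0 : 0 < m by rewrite lt_min ltr01.
have mq : m * (1 + q) <= 1 + T * q.
  rewrite mulrDr mulr1 lerD ?ge_min ?lexx// ler_pM2r//.
  by rewrite (le_trans _ UT)// ge_min lexx orbT.
have q1 : 0 < 1 + q by rewrite addr_gt0.
have Tq1 : 0 < 1 + T * q by rewrite addr_gt0// mulr_gt0.
rewrite ler_pdivrMr ?exprn_gt0//.
have -> : V / m ^+ 2 * (q / (1 + q) ^+ 2) * (1 + T * q) ^+ 2 =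
    V * q * ((1 + T * q) / (m * (1 + q))) ^+ 2.
  by field; rewrite !gt_eqF.
apply: (@le_trans _ _ (V * q)); first by rewrite ler_pM2r.
have Vq0 : 0 <= V * q by exact/ltW/mulr_gt0.
rewrite ler_peMr// exprn_ege1// ler_pdivlMr ?mul1r//.
by rewrite mulr_gt0.
Qed.

End bump.

(** The majorant for products of two functions of size O(1 / (1 + t)). *)
Lemma integrable_1DVsqr (R : realType) :
  mu.-integrable pos (EFin \o (fun x : R => (1 + x) ^- 2)).
Proof.
apply: (@integrable_bounded_primitive _ _ (fun x => - (1 + x)^-1) 1).
- move=> x x0; have x1 : (1 + x) ^+ 2 != 0 by rewrite expf_neq0// gt_eqF// addr_gt0.
  apply: cvgV => //; have dD : is_derive x 1 (fun x : R => 1 + x) (0 + 1) by exact: is_deriveD.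
  rewrite expr2; under eq_fun do rewrite expr2.
  by apply: cvgM; exact: is_derive1_continuous dD.
- by move=> x x0; rewrite invr_ge0 exprn_ge0// addr_ge0// ltW.
- move=> x x0; have x1 : 1 + x != 0 by rewrite gt_eqF// addr_gt0.
  apply: is_derive_eq.
  by rewrite /GRing.scale/= add0r mulr1 opprK.
- move=> x x0; have x1 : 0 < 1 + x by rewrite addr_gt0.
  by rewrite normrN gtr0_norm ?invr_gt0// invf_le1// lerDl ltW.
Qed.

(** * Decay of the functions generated by the Euler operator *)

(** The factor 1 + x makes both f x and f x / x integrable over (0, oo); the
    first gives the decay of the transform at infinity, the second its
    boundedness. *)
Definition tame {R : realType} (a : R) (f : R -> R) :=
  exists2 C, 0 <= C & forall x : R, 0 < x -> (1 + x) * `|f x| <= C * bump a x.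

(** Near 0 one has |h x| <= x^a, near infinity |h x| <= x^(-1-a), and there
    bump a x / (1 + x) is comparable to these powers because x^a lies on a known
    side of 1; in between, the quotient of the two sides is continuous, hence
    bounded on a compact interval. *)
Lemma tame_of_limits (R : realType) (a : R) (h : R -> R) :
  0 < a -> (forall x : R, 0 < x -> {for x, continuous h}) ->
  x `^ (- a) * h x @[x --> 0^'+] --> 0 ->
  x `^ (1 + a) * h x @[x --> +oo] --> 0 -> tame a h.
Proof.
move=> a0 ch h0 hoo.
have [d d0 near0] : exists2 d : R, 0 < d &
    forall x, 0 < x -> x < d -> `|x `^ (- a) * h x| <= 1.
  have [d /= d0 hd] := @cvgr0_norm_le _ _ _ _ _ _ h0 1 ltr01.
  exists d => // x x0 xd; apply: hd => //=.
  by rewrite sub0r normrN gtr0_norm.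
have [M [Mreal nearoo]] := @cvgr0_norm_le _ _ _ _ _ _ hoo 1 ltr01.
pose e := Num.min d 1; pose N := Num.max M 1.
have e0 : 0 < e by rewrite lt_min d0 ltr01.
have e1 : e <= 1 by rewrite ge_min lexx orbT.
have N1 : 1 <= N by rewrite le_max lexx orbT.
pose q x := (1 + x) * `|h x| / bump a x.
have bump_gt0 x : 0 < x -> 0 < bump a x.
  by move=> x0; rewrite /bump divr_gt0 ?exprn_gt0 ?powR1D_gt0 ?powR_gt0.
have cq x : 0 < x -> {for x, continuous q}.
  move=> x0; apply: cvgM; last first.
    by apply: cvgV; [rewrite gt_eqF ?bump_gt0|exact: continuous_bump].
  apply: cvgM; first by apply: cvgD; [exact: cvg_cst|exact: cvg_id].
  by apply: cvg_norm; exact: ch.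
have [c _ qc] : exists2 c, c \in `[e, N] & forall t, t \in `[e, N] -> q t <= q c.
  apply: EVT_max; first exact: le_trans N1.
  apply: continuous_in_subspaceT => x; rewrite inE/= in_itv/= => /andP[ex _].
  exact/cq/(lt_le_trans e0).
(* 8 = 2 * 2 ^ 2 bounds (1 + x) * (1 + x^a)^2 for x <= 1, and its quotient by
   x * x^(2 * a) for x >= 1. *)
exists (8 + `|q c|); first by rewrite addr_ge0.
move=> x x0.
suff : (1 + x) * `|h x| <= 8 * bump a x \/ (1 + x) * `|h x| <= `|q c| * bump a x.
  case=> hx; apply: (le_trans hx); rewrite [leRHS]mulrDl.
    by rewrite lerDl mulr_ge0// bump_ge0.
  by rewrite lerDr mulr_ge0// bump_ge0.
have xa0 : 0 < x `^ a by exact: powR_gt0.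
have [xe|ex] := ltP x e.
  left; have := near0 x x0; rewrite (lt_le_trans xe) ?ge_min ?lexx// => /(_ isT).
  rewrite normrM powRN normfV (gtr0_norm xa0) mulrC ler_pdivrMr// mul1r => hx.
  have x1 : x <= 1 by exact: le_trans (ltW xe) e1.
  have q1 : x `^ a <= 1 by rewrite -(powRr0 x); apply: ger_powR (ltW a0); rewrite x0.
  rewrite /bump mulrA ler_pdivlMr ?exprn_gt0 ?powR1D_gt0//.
  apply: (@le_trans _ _ (2 * x `^ a * 2 ^+ 2)); last by lra.
  apply: ler_pM; [by rewrite mulr_ge0//; lra|exact/exprn_ge0/ltW/powR1D_gt0| |].
    by apply: ler_pM => //; lra.
  by rewrite lerXn2r ?nnegrE//; lra.
have [xN|Nx] := leP x N.
  right; rewrite -ler_pdivrMr ?bump_gt0//.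
  by apply: (le_trans (qc x _)); [rewrite in_itv/= ex|exact: ler_norm].
left; have := nearoo x; rewrite (le_lt_trans _ Nx) ?le_max ?lexx// => /(_ isT).
have x1 : 1 <= x by exact: le_trans N1 (ltW Nx).
have q1 : 1 <= x `^ a by rewrite -(powRr0 x); apply: ler_powR (ltW a0).
rewrite powRD ?(gt_eqF x0) ?implybT// (powRr1 (ltW x0)).
rewrite normrM (gtr0_norm (mulr_gt0 x0 xa0)) /bump; move: (x `^ a) xa0 q1 => Q Q0 Q1 hx.
rewrite mulrA ler_pdivlMr ?exprn_gt0 ?addr_gt0//.
have h2 : (1 + x) * `|h x| * (1 + Q) <= (2 * x) * `|h x| * (2 * Q).
  by apply: ler_pM; [rewrite mulr_ge0//; lra|lra|apply: ler_pM => //; lra|lra].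
have h3 : (1 + x) * `|h x| * (1 + Q) <= 4.
  by apply: (le_trans h2); rewrite (_ : _ * (2 * Q) = 4 * (x * Q * `|h x|)); [lra|ring].
rewrite expr2 mulrA.
apply: (@le_trans _ _ (4 * (2 * Q))); last by lra.
by apply: ler_pM => //; [rewrite !mulr_ge0//; lra|lra|lra].
Qed.

(** The linear span of the functions x^i h^(i). Membership depends only on the
    values on (0, oo), as does the recursion defining the functions g_n. *)
Inductive euler_span {R : realType} (h : R -> R) : (R -> R) -> Prop :=
| euler_span_monomial i f :
    (forall x : R, 0 < x -> f x = x ^+ i * derive1n i h x) -> euler_span h f
| euler_span_comb b c f1 f2 f : euler_span h f1 -> euler_span h f2 ->
    (forall x : R, 0 < x -> f x = b * f1 x + c * f2 x) -> euler_span h f.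

Lemma near_pos (R : realType) (x : R) (P : R -> Prop) :
  0 < x -> (forall y : R, 0 < y -> P y) -> \forall y \near x, P y.
Proof.
by move=> x0 HP; near=> y; apply: HP; near: y; exact: lt_nbhsr.
Unshelve. all: by end_near. Qed.

Lemma is_derive_exprn (R : realType) (i : nat) (x : R) : 0 < x ->
  is_derive x 1 (fun y : R => y ^+ i) (i%:R * x ^+ i / x).
Proof.
move=> x0; have xn0 : x != 0 by rewrite gt_eqF.
elim: i => [|i IH].
  by under eq_fun do rewrite expr0; apply: is_derive_eq; rewrite !mul0r.
under eq_fun do rewrite exprS.
apply: (is_derive_eq (is_deriveM (is_derive_id x 1) IH)).
by rewrite /GRing.scale/= -natr1 exprS; field.
Qed.

(** The Euler operator sends x^i h^(i) to i x^i h^(i) + x^(i+1) h^(i+1). The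
    derivative is written e x / x so that the span is visibly stable. *)
Lemma euler_span_derive (R : realType) (h f : R -> R) :
  smooth_pos h -> euler_span h f ->
  exists2 e, euler_span h e & forall x : R, 0 < x -> is_derive x 1 f (e x / x).
Proof.
move=> sh; elim=> {f} [i f fE|b c f1 f2 f _ [e1 s1 d1] _ [e2 s2 d2] fE].
  pose m k (x : R) := x ^+ k * derive1n k h x.
  exists (fun x => i%:R * m i x + 1 * m i.+1 x).
    by apply: (@euler_span_comb _ _ i%:R 1 (m i) (m i.+1)) => //;
       exact: euler_span_monomial.
  move=> x x0; have xn0 : x != 0 by rewrite gt_eqF.
  apply: (@near_eq_is_derive _ _ _ (m i)).
    by apply: near_pos => // y y0; rewrite fE.
  have dh : is_derive x 1 (derive1n i h) (derive1n i.+1 h x).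
    by rewrite derive1nS derive1E; apply: derivableP; exact: sh.
  apply: (is_derive_eq (is_deriveM (is_derive_exprn _ i _ x0) dh)).
  by rewrite /GRing.scale/= -derive1nS /m exprS; field.
exists (fun x => b * e1 x + c * e2 x); first exact: (@euler_span_comb _ _ b c e1 e2).
move=> x x0.
apply: (@near_eq_is_derive _ _ _ (fun x => b * f1 x + c * f2 x)).
  by apply: near_pos => // y y0; rewrite fE.
have := d1 x x0; have := d2 x x0 => D2 D1.
apply: (is_derive_eq (is_deriveD (is_deriveZ b D1) (is_deriveZ c D2))).
by rewrite /GRing.scale/= mulrDl !mulrA.
Qed.

Lemma euler_span_tame (R : realType) (a : R) (h f : R -> R) :
  (forall i, tame a (fun x => x ^+ i * derive1n i h x)) ->
  euler_span h f -> tame a f.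
Proof.
move=> th; elim=> {f} [i f fE|b c f1 f2 f _ [C1 C10 h1] _ [C2 C20 h2] fE].
  by have [C C0 hC] := th i; exists C => // x x0; rewrite fE// hC.
exists (`|b| * C1 + `|c| * C2); first by rewrite addr_ge0// mulr_ge0.
move=> x x0; rewrite fE//.
apply: (@le_trans _ _ (`|b| * ((1 + x) * `|f1 x|) + `|c| * ((1 + x) * `|f2 x|))).
  rewrite !(mulrCA _ (1 + x)) -mulrDr ler_pM2l ?addr_gt0//.
  by rewrite (le_trans (ler_normD _ _))// !normrM.
by rewrite [leRHS]mulrDl -![_ * _ * bump a x]mulrA lerD// ler_wpM2l// ?h1 ?h2.
Qed.

(** * The transform of a tame function *)

Lemma integrable_pos_scale (R : realType) (c : R) (f : R -> R) :
  mu.-integrable pos (EFin \o f) ->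
  mu.-integrable pos (EFin \o (fun x => c * f x)).
Proof.
move=> intf.
have := integrableZl (measurable_pos R) c intf.
by apply: (eq_integrable (measurable_pos R)).
Qed.

Lemma frac_ge0 (R : realType) (y : R) : 0 <= Defs.frac y.
Proof. by rewrite /Defs.frac subr_ge0 floor_le. Qed.

Lemma frac_le1 (R : realType) (y : R) : Defs.frac y <= 1.
Proof. by rewrite /Defs.frac lerBlDl -intrD1 ltW// floorD1_gt. Qed.

Lemma frac_le (R : realType) (y : R) : 0 <= y -> Defs.frac y <= y.
Proof. by move=> y0; rewrite /Defs.frac gerBl ler0z floor_ge0. Qed.

Lemma measurable_frac (R : realType) (D : set (measurableTypeR R)) :
  measurable D -> measurable_fun D (@Defs.frac R).
Proof.
move=> mD; apply: measurable_funB; first exact: measurable_id.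
by apply: nondecreasing_measurable => // x y xy; rewrite ler_int le_floor.
Qed.

Section gtimes_of_tame.
Context {R : realType} (a : R).
Hypothesis a_gt0 : 0 < a.
Implicit Types (f e : R -> R) (t x : R).

Lemma tame_le_bump f (C x : R) : 0 < x ->
  (1 + x) * `|f x| <= C * bump a x -> `|f x| <= C * bump a x.
Proof.
move=> x0; apply: le_trans; rewrite ler_peMl// lerDl ltW//.
Qed.

(** Uses both bounds of the fractional part: frac y <= 1 for the summand 1 of
    1 + t, and frac (x / t) <= x / t for the summand t. *)
Lemma kernel_le (C t x : R) f : 0 < t -> 0 < x ->
  (1 + x) * `|f x| <= C * bump a x ->
  (1 + t) * `|Defs.frac (x / t) * f x / x| <= C * (bump a x / x).
Proof.
move=> t0 x0 fC; have xt0 : 0 <= x / t by rewrite divr_ge0// ltW.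
have fr0 := frac_ge0 _ (x / t).
have fr_le : (1 + t) * Defs.frac (x / t) <= 1 + x.
  rewrite mulrDl mul1r lerD ?frac_le1//.
  by rewrite mulrC -ler_pdivlMr// frac_le.
rewrite !normrM (ger0_norm fr0) normfV (gtr0_norm x0) ![in leLHS]mulrA [leRHS]mulrA.
rewrite ler_pM2r ?invr_gt0//; apply: (le_trans _ fC).
by rewrite ler_wpM2r.
Qed.

Lemma integrable_kernel f t : 0 < t ->
  (forall x, 0 < x -> {for x, continuous f}) -> tame a f ->
  mu.-integrable pos (EFin \o (fun x => Defs.frac (x / t) * f x / x)).
Proof.
move=> t0 cf [C C0 fC].
apply: (le_integrable (measurable_pos R) (g := EFin \o (fun x => C * (bump a x / x)))) => //.
- apply/measurable_EFinP/measurable_funM; last first.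
    by apply: continuous_pos_measurable => x x0; apply: inv_continuous; rewrite gt_eqF.
  apply: measurable_funM; last exact: continuous_pos_measurable.
  apply: measurableT_comp; first exact: measurable_frac.
  exact: measurable_funM.
- move=> x /posP x0 /=; rewrite lee_fin.
  rewrite [leRHS]ger0_norm; last first.
    by rewrite mulr_ge0// divr_ge0 ?bump_ge0// ltW.
  apply: (le_trans _ (kernel_le _ _ _ _ t0 x0 (fC x x0))).
  by rewrite ler_peMl// lerDl ltW.
- by apply: integrable_pos_scale; exact: integrable_bump.
Qed.

Lemma gtimes_bounded f :
  (forall x, 0 < x -> {for x, continuous f}) -> tame a f ->
  exists2 M, 0 <= M & forall t, 0 < t -> (1 + t) * `|gtimes f t| <= M.
Proof.
move=> cf tf; have [C C0 fC] := tf.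
have intb := integrable_bump _ a_gt0.
exists (C * \int[mu]_(x in pos) (bump a x / x)).
  rewrite mulr_ge0// Rintegral_ge0// => x /posP x0.
  by rewrite divr_ge0 ?bump_ge0// ltW.
move=> t t0; have t1 : 0 < 1 + t by rewrite addr_gt0.
have intk := integrable_kernel _ _ t0 cf tf.
rewrite mulrC -ler_pdivlMr// mulrAC -RintegralZl//.
rewrite (le_trans (le_normr_Rintegral _ intk))//.
apply: le_Rintegral => //.
- exact: (integrable_norm intk).
- exact: integrable_pos_scale.
- move=> x /posP x0; rewrite [leRHS]mulrAC ler_pdivlMr// [leLHS]mulrC.
  exact: (kernel_le _ _ _ _ t0 x0 (fC x x0)).
Qed.

(** After the substitution x = t * u the parameter t no longer occurs in the
    fractional part, which makes the integrand differentiable in t. *)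
Lemma gtimes_dilation f t : 0 < t ->
  (forall x, 0 < x -> {for x, continuous f}) -> tame a f ->
  mu.-integrable pos (EFin \o (fun u => Defs.frac u * f (t * u) / u)) /\
  gtimes f t = \int[mu]_(u in pos) (Defs.frac u * f (t * u) / u).
Proof.
move=> t0 cf tf; have tn0 : t != 0 by rewrite gt_eqF.
have [int1 int2] := integral_dilation _ _ _ t0 (integrable_kernel _ _ t0 cf tf).
have E : {in pos, (fun u => t * (Defs.frac (t * u / t) * f (t * u) / (t * u))) =1
                  (fun u => Defs.frac u * f (t * u) / u)}.
  move=> u /set_mem/posP u0; have un0 : u != 0 by rewrite gt_eqF.
  by have /= -> : t * u / t = u; [field|field; rewrite un0].
split.
  apply: (eq_integrable (measurable_pos R) _ _ _ (integrable_pos_scale _ t _ int1)).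
  by move=> u /E /= ->.
by rewrite [LHS]int2 -RintegralZl//; exact: eq_Rintegral.
Qed.

(** The transform commutes with the Euler operator. For s between t / 2 and
    2 * t the derivative of the integrand, frac u * e (s * u) / (s * u), is
    dominated by a multiple of bump a u / u, so one may differentiate under the
    integral sign. *)
Lemma is_derive_gtimes f e t : 0 < t ->
  (forall x, 0 < x -> is_derive x 1 f (e x / x)) ->
  (forall x, 0 < x -> {for x, continuous e}) ->
  tame a f -> tame a e ->
  is_derive t 1 (gtimes f) (gtimes e t / t).
Proof.
move=> t0 df ce tf te; have [C C0 eC] := te.
have cf (x : R) : 0 < x -> {for x, continuous f}.
  by move=> x0; exact: is_derive1_continuous _ _ _ _ (df x x0).
pose k s u := Defs.frac u * f (s * u) / u.
have dk (s u : R) : 0 < s -> 0 < u ->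
    is_derive s 1 (k ^~ u) (Defs.frac u * e (s * u) / (s * u)).
  move=> s0 u0; have su0 : 0 < s * u by exact: mulr_gt0.
  have dsu : is_derive s 1 (fun s => s * u) u.
    by apply: is_derive_eq; rewrite /GRing.scale/= mulr1 mulr0 ?add0r ?addr0.
  have dfu := @is_derive1_comp _ f (fun s => s * u) s _ _ (df _ su0) dsu.
  rewrite (_ : k ^~ u = (fun s => (Defs.frac u / u) * f (s * u))); last first.
    by apply/funext => y; rewrite /k mulrAC.
  apply: (is_derive_eq (is_deriveZ (Defs.frac u / u) dfu)).
  rewrite /GRing.scale/=; field.
  by rewrite !gt_eqF.
pose u0 := t / 2; pose v0 := 2 * t.
have It : t \in `]u0, v0[.
  by rewrite in_itv/= /u0 /v0; apply/andP; split; lra.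
have u00 : 0 < u0 by rewrite divr_gt0.
have Ipos (s : R) : `]u0, v0[%classic s -> 0 < s.
  by rewrite /= in_itv/= => /andP[+ _]; exact: lt_trans.
pose K := C * (v0 `^ a / Num.min 1 (u0 `^ a) ^+ 2) / u0.
have K0 : 0 <= K.
  rewrite /K divr_ge0 ?(ltW u00)// mulr_ge0// divr_ge0 ?powR_ge0// exprn_ge0//.
  by rewrite le_min ler01 powR_ge0.
have kK (s u : R) : `]u0, v0[%classic s -> pos u ->
    `|partial1of2 k s u| <= K * `|bump a u / u|.
  move=> Is /posP up; have s0 := Ipos s Is.
  move: Is; rewrite /= in_itv/= => /andP[/ltW u0s /ltW sv0].
  have su0 : 0 < s * u by exact: mulr_gt0.
  rewrite partial1of2E (@derive_val _ _ _ _ _ _ _ (dk _ _ s0 up)).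
  rewrite [X in _ <= K * X]ger0_norm; last by rewrite divr_ge0 ?bump_ge0// ltW.
  rewrite ![in leLHS]normrM normfV (gtr0_norm su0) (ger0_norm (frac_ge0 _ u)).
  have h1 : Defs.frac u * `|e (s * u)| <= C * (v0 `^ a / Num.min 1 (u0 `^ a) ^+ 2) * bump a u.
    apply: (@le_trans _ _ `|e (s * u)|); first by rewrite ler_piMl// frac_le1.
    apply: (le_trans (tame_le_bump _ _ _ su0 (eC _ su0))).
    by rewrite -mulrA ler_wpM2l//; exact: bump_dilation.
  rewrite invfM (mulrC s^-1) mulrA ler_pdivrMr//.
  rewrite /K [leRHS](_ : _ = (C * (v0 `^ a / Num.min 1 (u0 `^ a) ^+ 2) * bump a u)
     / u * (s / u0)); last by ring.
  rewrite -[leLHS]mulr1; apply: ler_pM => //.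
  - by rewrite mulr_ge0 ?invr_ge0 ?(ltW up)// mulr_ge0 ?frac_ge0.
  - by rewrite ler_pM2r ?invr_gt0.
  - by rewrite ler_pdivlMr// mul1r.
have intk (s : R) : `]u0, v0[%classic s -> mu.-integrable pos (EFin \o k s).
  by move=> /Ipos s0; have [] := gtimes_dilation _ _ s0 cf tf.
have derk (s u : R) : `]u0, v0[%classic s -> pos u -> derivable (k ^~ u) s 1.
  by move=> /Ipos s0 /posP up; have [] := dk _ _ s0 up.
have intG : mu.-integrable pos (EFin \o (fun u => K * `|bump a u / u|)).
  by apply: integrable_pos_scale; apply: integrable_norm; exact: integrable_bump.
(* The dominating function must be nonnegative at every real u, hence the
   absolute value in it. *)
have G0 (u : R) : 0 <= K * `|bump a u / u| by rewrite mulr_ge0.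
have dF := derivable_under_integral (measurable_pos R) It intk derk G0 intG kK.
have dE := differentiation_under_integral (measurable_pos R) It intk derk G0 intG kK.
apply: (@near_eq_is_derive _ _ _ (fun s => \int[mu]_(u in pos) k s u)).
  by apply: near_pos _ _ _ t0 _ => s s0; have [_ ->] := gtimes_dilation _ _ s0 cf tf.
apply: is_derive_eq; first exact: derivableP dF.
rewrite -derive1E dE.
have [int1 ->] := gtimes_dilation _ _ t0 ce te.
rewrite -RintegralZr//; apply: eq_Rintegral => u /set_mem/posP up.
rewrite partial1of2E (@derive_val _ _ _ _ _ _ _ (dk _ _ t0 up)).
by field; rewrite !gt_eqF.
Qed.

End gtimes_of_tame.

(** * Products of two functions of size O(1 / (1 + t)) *)

Lemma bounded_pair_integrable (R : realType) (F G : R -> R) (M N : R) :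
  0 <= M ->
  (forall t : R, 0 < t -> {for t, continuous F}) ->
  (forall t : R, 0 < t -> {for t, continuous G}) ->
  (forall t : R, 0 < t -> (1 + t) * `|F t| <= M) ->
  (forall t : R, 0 < t -> (1 + t) * `|G t| <= N) ->
  mu.-integrable pos (EFin \o (fun t => F t * G t)).
Proof.
move=> M0 cF cG FM GN.
have bnd (t : R) : 0 < t -> `|F t * G t| <= M * N * (1 + t) ^- 2.
  move=> t0; have t1 : 0 < 1 + t by rewrite addr_gt0.
  rewrite ler_pdivlMr ?exprn_gt0//.
  have -> : `|F t * G t| * (1 + t) ^+ 2 = ((1 + t) * `|F t|) * ((1 + t) * `|G t|).
    by rewrite normrM; ring.
  by apply: ler_pM; [exact/mulr_ge0/normr_ge0/ltW|exact/mulr_ge0/normr_ge0/ltW|exact: FM|exact: GN].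
apply: (le_integrable (measurable_pos R)
  (g := EFin \o (fun x => M * N * (1 + x) ^- 2))) => //.
- apply/measurable_EFinP; apply: continuous_pos_measurable => t t0.
  by apply: cvgM; [exact: cF|exact: cG].
- move=> t /posP t0; rewrite lee_fin.
  exact: le_trans (bnd t t0) (ler_norm _).
- by apply: integrable_pos_scale; exact: integrable_1DVsqr.
Qed.

Lemma bounded_pair_vanish (R : realType) (F G : R -> R) (M N : R) :
  0 <= M -> 0 <= N ->
  (forall t : R, 0 < t -> (1 + t) * `|F t| <= M) ->
  (forall t : R, 0 < t -> (1 + t) * `|G t| <= N) ->
  t * (F t * G t) @[t --> 0^'+] --> 0 /\ t * (F t * G t) @[t --> +oo] --> 0.
Proof.
move=> M0 N0 FM GN.
have bnd (t : R) : 0 < t -> `|t * (F t * G t)| <= M * N * (t / (1 + t) ^+ 2).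
  move=> t0; have t1 : 0 < 1 + t by rewrite addr_gt0.
  rewrite [leRHS]mulrA ler_pdivlMr ?exprn_gt0//.
  have -> : `|t * (F t * G t)| * (1 + t) ^+ 2 =
      ((1 + t) * `|F t|) * ((1 + t) * `|G t|) * t.
    by rewrite !normrM (gtr0_norm t0); ring.
  rewrite ler_pM2r//.
  by apply: ler_pM; [exact/mulr_ge0/normr_ge0/ltW|exact/mulr_ge0/normr_ge0/ltW|exact: FM|exact: GN].
have MN0 : 0 <= M * N by exact: mulr_ge0.
have MN1 : 0 < M * N + 1 by rewrite ltr_wpDl.
have q0 (t : R) : 0 < t -> 0 <= t / (1 + t) ^+ 2.
  by move=> t0; rewrite divr_ge0 ?exprn_ge0//; lra.
split; apply/cvgr0Pnorm_le => e e0.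
- near=> t; have t0 : 0 < t by near: t; exact: nbhs_right_gt.
  have t1 : 0 < (1 + t) ^+ 2 by rewrite exprn_gt0//; lra.
  apply: (le_trans (bnd t t0)).
  apply: (@le_trans _ _ ((M * N + 1) * t)).
    apply: ler_pM => //; [exact: q0|by rewrite lerDl|].
    by rewrite ler_pdivrMr// ler_peMr ?(ltW t0)// exprn_ege1//; lra.
  rewrite mulrC -ler_pdivlMr//; near: t; apply: nbhs_right_le.
  by rewrite divr_gt0.
- near=> t; have t0 : 0 < t by near: t; exact: nbhs_pinfty_gt.
  have t1 : 0 < (1 + t) ^+ 2 by rewrite exprn_gt0//; lra.
  apply: (le_trans (bnd t t0)).
  apply: (@le_trans _ _ ((M * N + 1) / t)).
    apply: ler_pM => //; [exact: q0|by rewrite lerDl|].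
    by rewrite ler_pdivrMr// mulrC ler_pdivlMr//; nra.
  rewrite ler_pdivrMr// [leRHS]mulrC -ler_pdivrMr//; near: t.
Unshelve. all: by end_near. Qed.

(** * Integration by parts for the transforms *)

Theorem proposition2 (R : realType) (r : nat -> R) (g : nat -> R -> R)
    (alpha : R)
    (g0_smooth : smooth_pos (g 0%N))
    (alpha_gt0 : 0 < alpha)
    (g0_lim0 : forall k : nat,
      x `^ (k%:R - alpha) * derive1n k (g 0%N) x @[x --> 0^'+] --> 0)
    (g0_limoo : forall k : nat,
      x `^ (k%:R + 1 + alpha) * derive1n k (g 0%N) x @[x --> +oo] --> 0)
    (g_rec : forall (k : nat) (x : R), 0 < x ->
      g k.+1 x = - x * derive1 (g k) x - r k * g k x)
    (k j : nat) (j_ge1 : (1 <= j)%N) :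
  dotL2 (gtimes (g k)) (gtimes (g j))
    + dotL2 (gtimes (g k.+1)) (gtimes (g j.-1))
  = (1 - r k - r j.-1) * dotL2 (gtimes (g k)) (gtimes (g j.-1)).
Proof.
have mono_cont i (x : R) : 0 < x ->
    {for x, continuous (fun x : R => x ^+ i * derive1n i (g 0%N) x)}.
  move=> x0; apply: cvgM; first exact: exprn_continuous.
  by apply: is_derive1_continuous (derivableP (g0_smooth i x x0)).
(* The weights in the two limits are x^i times x^(-alpha), respectively x^i
   times x^(1 + alpha), so the limits bear on the spanning functions. *)
have mono_tame i : tame alpha (fun x : R => x ^+ i * derive1n i (g 0%N) x).
  apply: tame_of_limits => //; first exact: mono_cont.
    apply: cvg_trans (g0_lim0 i); apply: near_eq_cvg; near=> x.
    have x0 : 0 < x by near: x; exact: nbhs_right_gt.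
    rewrite addrC powRD ?(gt_eqF x0) ?implybT// mulrA.
    by rewrite (powR_mulrn _ (ltW x0)).
  apply: cvg_trans (g0_limoo i); apply: near_eq_cvg; near=> x.
  have x0 : 0 < x by near: x; exact: nbhs_pinfty_gt.
  rewrite -addrA addrC powRD ?(gt_eqF x0) ?implybT// mulrA.
  by rewrite (powR_mulrn _ (ltW x0)).
have g_span n : euler_span (g 0%N) (g n).
  elim: n => [|n IH].
    by apply: (@euler_span_monomial _ _ 0) => x _; rewrite expr0 mul1r.
  have [e se de] := euler_span_derive _ _ _ g0_smooth IH.
  apply: (@euler_span_comb _ _ (-1) (- r n) e (g n)) => // x x0.
  rewrite g_rec// derive1E (@derive_val _ _ _ _ _ _ _ (de x x0)).
  by field; rewrite gt_eqF.
have g_tame n : tame alpha (g n) := euler_span_tame _ _ _ _ mono_tame (g_span n).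
have dg n (x : R) : 0 < x ->
    is_derive x 1 (g n) ((- g n.+1 x - r n * g n x) / x).
  move=> x0; have [e _ de] := euler_span_derive _ _ _ g0_smooth (g_span n).
  apply: (is_derive_eq (de x x0)).
  rewrite g_rec// derive1E (@derive_val _ _ _ _ _ _ _ (de x x0)).
  by field; rewrite gt_eqF.
have cg n (x : R) : 0 < x -> {for x, continuous (g n)}.
  by move=> x0; exact: is_derive1_continuous (dg n x x0).
(* The Euler operator maps g_n to - g_(n+1) - r_n * g_n. *)
have dgt n (t : R) : 0 < t -> is_derive t 1 (gtimes (g n))
    (- (gtimes (g n.+1) t + r n * gtimes (g n) t) / t).
  move=> t0.
  have span_e : euler_span (g 0%N) (fun x : R => - g n.+1 x - r n * g n x).
    apply: (@euler_span_comb _ _ (-1) (- r n) (g n.+1) (g n)) => // x _.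
    by rewrite mulN1r mulNr.
  have ce (x : R) : 0 < x -> {for x, continuous (fun x : R => - g n.+1 x - r n * g n x)}.
    move=> x0; apply: cvgB; first by apply: cvgN; exact: cg.
    by apply: cvgM; [exact: cvg_cst|exact: cg].
  have := is_derive_gtimes _ alpha_gt0 _ _ _ t0 (dg n) ce (g_tame n)
    (euler_span_tame _ _ _ _ mono_tame span_e).
  move=> /is_derive_eq; apply; congr (_ / _).
  pose K m x := Defs.frac (x / t) * g m x / x.
  have intK m : mu.-integrable pos (EFin \o K m).
    exact: integrable_kernel alpha_gt0 _ _ t0 (cg m) (g_tame m).
  have intrK := integrable_pos_scale _ (r n) _ (intK n).
  have intS : mu.-integrable pos (EFin \o (fun x => K n.+1 x + r n * K n x)).
    exact: (integrableD (measurable_pos R) (intK n.+1) intrK).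
  have -> : - (gtimes (g n.+1) t + r n * gtimes (g n) t) =
      \int[mu]_(x in pos) (-1 * (K n.+1 x + r n * K n x)).
    rewrite (RintegralZl (-1) (measurable_pos R) intS) mulN1r RintegralD//.
    by rewrite RintegralZl.
  by apply: eq_Rintegral => x _; rewrite /K; ring.
case: j j_ge1 => // j _ /=.
set Fk := gtimes (g k); set Fj := gtimes (g j).
set Fk1 := gtimes (g k.+1); set Fj1 := gtimes (g j.+1).
have cF n (t : R) : 0 < t -> {for t, continuous (gtimes (g n))}.
  by move=> t0; exact: is_derive1_continuous (dgt n t t0).
have bF n := gtimes_bounded _ alpha_gt0 _ (cg n) (g_tame n).
have intF m n : mu.-integrable pos (EFin \o (fun t => gtimes (g m) t * gtimes (g n) t)).
  have [M M0 HM] := bF m; have [N N0 HN] := bF n.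
  exact: (bounded_pair_integrable _ _ _ _ _ M0 (cF m) (cF n) HM HN).
pose c := 1 - r k - r j.
(* D is the derivative of t * F_k t * F_j t, with j standing for j - 1. *)
pose D t := c * (Fk t * Fj t) - (Fk t * Fj1 t + Fk1 t * Fj t).
have dD (t : R) : 0 < t -> is_derive t 1 (fun t => t * (Fk t * Fj t)) (D t).
  move=> t0; have dk := dgt k t t0; have dj := dgt j t t0.
  apply: (is_derive_eq (is_deriveM (is_derive_id t 1) (is_deriveM dk dj))).
  rewrite /GRing.scale/= /D /c !fctE -/Fk -/Fj -/Fk1 -/Fj1.
  by field; rewrite gt_eqF.
have cD (t : R) : 0 < t -> {for t, continuous D}.
  move=> t0; apply: cvgB.
    by apply: cvgM; [exact: cvg_cst|apply: cvgM; exact: cF].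
  by apply: cvgD; apply: cvgM; exact: cF.
have int1 := integrable_pos_scale _ c _ (intF k j).
have int2 : mu.-integrable pos (EFin \o (fun t => Fk t * Fj1 t + Fk1 t * Fj t)).
  exact: (integrableD (measurable_pos R) (intF k j.+1) (intF k.+1 j)).
have intD : mu.-integrable pos (EFin \o D).
  exact: (integrableB (measurable_pos R) int1 int2).
have [M M0 HM] := bF k; have [N N0 HN] := bF j.
have [van0 vanoo] := bounded_pair_vanish _ _ _ _ _ M0 N0 HM HN.
have := Rintegral_primitive_vanishing _ _ _ cD dD intD van0 vanoo.
rewrite /D (RintegralB (measurable_pos R) int1 int2).
rewrite (RintegralZl c (measurable_pos R) (intF k j)).
rewrite (RintegralD (measurable_pos R) (intF k j.+1) (intF k.+1 j)).
by move=> /eqP; rewrite subr_eq0 => /eqP <-.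
Unshelve. all: by end_near. Qed.
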